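(* Let $N\ge 2$ and let $$\Phi_N(x_1,\ldots,x_N)=\sum_{d=1}^N(-1)^d\frac{1}{d}\sum_{\substack{(i_1,\ldots,i_d)\in\{1,2,\ldots,N\}^d\\ i_1+\cdots+i_d=N}}x_{i_1}x_{i_2}\cdots x_{i_d}.$$ Then for every $p\in\{1,2,\ldots,N-1\}$ the vector field $$X_p=\frac{\partial}{\partial x_p}+\sum_{h=p+1}^N x_{h-p}\frac{\partial}{\partial x_h}$$ annihilates $\Phi_N$, i.e. $X_p\Phi_N=0$ identically as a polynomial in $x_1,\ldots,x_N$.
   Context: The variables $x_1,\ldots,x_N$ are the standard coordinates on real affine space $\mathbb{R}^N$. The inner sum in $\Phi_N$ runs over all ordered $d$-tuples of positive integers with sum $N$. For example, $\Phi_3=-x_3+x_1x_2-\frac13x_1^3$. *)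

(* Defs.v *)
From mathcomp Require Import all_boot all_order all_algebra.
From mathcomp Require Import mpoly.

Set Implicit Arguments.
Unset Strict Implicit.
Unset Printing Implicit Defensive.

Import GRing.Theory.
Local Open Scope ring_scope.

(* Indices are shifted by one: for i : 'I_N the variable 'X_i stands for
   x_{i+1}, and f^`M(i) for the derivative of f with respect to x_{i+1}. *)

(* A d-tuple t over 'I_N encodes (t_0 + 1, ..., t_{d-1} + 1) in {1, ..., N}^d. *)
Definition Phi (R : realFieldType) (N : nat) : {mpoly R[N]} :=
  \sum_(1 <= d < N.+1)
    ((-1) ^+ d * d%:R^-1) *:
      \sum_(t : d.-tuple 'I_N | (\sum_(k < d) (tnth t k).+1 == N)%N)
        \prod_(k < d) 'X_(tnth t k).

(* For p < h, the difference of the one-based indices h+1 and p+1 is h-p,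
   whose zero-based counterpart is h - (p+1). *)
Definition ord_diff (N : nat) (h p : 'I_N) : 'I_N :=
  Ordinal (leq_ltn_trans (leq_subr p.+1 h) (ltn_ord h)).

(* The vector field d/dx_q + sum_(q < h <= N) x_(h-q) d/dx_h, with q = p + 1,
   given as a derivation on polynomials. *)
Definition X_field (R : realFieldType) (N : nat) (p : 'I_N)
    (f : {mpoly R[N]}) : {mpoly R[N]} :=
  f^`M(p) + \sum_(h < N | (p < h)%N) 'X_(ord_diff h p) * f^`M(h).

(* Main.v *)
Require Import Defs.
From HB Require Import structures.
From mathcomp Require Import all_boot all_order all_algebra.
From mathcomp Require Import mpoly.

Set Implicit Arguments.
Unset Strict Implicit.
Unset Printing Implicit Defensive.

Import GRing.Theory.
Local Open Scope ring_scope.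

(** Up to sign, [Phi R N] is the coefficient of z^N in log (1 + U), where
    U = x_1 z + ... + x_N z^N. Modulo z^(N+1) the field X_q maps U to
    z^q (1 + U), hence log (1 + U) to z^q, whose z^N-coefficient vanishes
    for q < N. *)

Section CoefficientwiseDerivation.

Variables (A : comNzRingType) (D : {additive A -> A}).
Hypothesis DM : forall f g, D (f * g) = D f * g + f * D g.

(** Applied to coefficients, [D] treats the indeterminate z as a constant, so the Leibniz rule holds
    in each term of the Cauchy product. *)
Lemma map_poly_derivationM (P Q : {poly A}) :
  map_poly D (P * Q) = map_poly D P * Q + P * map_poly D Q.
Proof.
apply/polyP => i; rewrite coef_map coefD !coefM raddf_sum -big_split /=.
by apply: eq_bigr => j _; rewrite DM !coef_map.
Qed.

Lemma map_poly_derivationXn (P : {poly A}) d :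
  map_poly D (P ^+ d) = (P ^+ d.-1 * map_poly D P) *+ d.
Proof.
have D1 : D 1 = 0.
  by apply: (addIr (D 1)); rewrite add0r -{3}[1]mul1r DM mul1r mulr1.
elim: d => [|d IHd].
  by rewrite expr0 mulr0n -[1]/(1%:P) map_polyC /= D1.
rewrite exprS map_poly_derivationM IHd mulrnAr mulrS mulrC /=; congr (_ + _).
(* For d = 0 the truncated exponent [d.-1] is harmless, since the multiple [*+ 0] kills the term. *)
by case: d {IHd} => [|d]; rewrite ?mulr0n //= mulrA -exprS.
Qed.

End CoefficientwiseDerivation.

Section VectorField.

Variables (R : realFieldType) (N : nat) (p : 'I_N).

Lemma X_field_is_linear : linear (@X_field R N p).
Proof.
move=> c f g; rewrite /X_field mderivD mderivZ scalerDr addrACA; congr (_ + _).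
rewrite scaler_sumr -big_split /=; apply: eq_bigr => h _.
by rewrite mderivD mderivZ mulrDr scalerAr.
Qed.

HB.instance Definition _ :=
  GRing.isLinear.Build R {mpoly R[N]} {mpoly R[N]} _ (@X_field R N p)
    X_field_is_linear.

Lemma X_fieldM (f g : {mpoly R[N]}) :
  X_field p (f * g) = X_field p f * g + f * X_field p g.
Proof.
rewrite /X_field mderivM mulrDl mulrDr addrACA; congr (_ + _).
rewrite mulr_suml mulr_sumr -big_split /=; apply: eq_bigr => h _.
by rewrite mderivM mulrDr [_ * (f * _)]mulrCA -[X in _ = X + _]mulrA.
Qed.

Lemma X_fieldX (i : 'I_N) :
  X_field p ('X_i : {mpoly R[N]}) =
    (i == p)%:R + (if (p < i)%N then 'X_(ord_diff i p) else 0).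
Proof.
have dX (j : 'I_N) : ('X_i : {mpoly R[N]})^`M(j) = (i == j)%:R.
  rewrite mderivX mnm1E; case: eqVneq => [->|_]; last by rewrite scale0r.
  have -> : (U_(j) - U_(j) = 0 :> 'X_{1.. N})%MM.
    by apply/mnmP => k; rewrite mnmBE mnm0E subnn.
  by rewrite mpolyX0 scale1r.
rewrite /X_field dX; congr (_ + _).
rewrite big_mkcond (bigD1 i) //= big1 ?addr0 => [|j /negbTE ne_ji].
  by rewrite dX eqxx mulr1.
by rewrite dX eq_sym ne_ji mulr0 if_same.
Qed.

End VectorField.

Section GeneratingPolynomial.

Variables (R : realFieldType) (N : nat).

Definition genpoly : {poly {mpoly R[N]}} := \sum_(i < N) 'X_i *: 'X^(i.+1).

(** Distributivity expands the power over all choices of one index per factor, that is, over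
    functions from ['I_d] to ['I_N], reindexed here by tuples. A choice contributes its monomial at
    z to the sum of its one-based indices. *)
Lemma coef_genpolyXn d :
  (genpoly ^+ d)`_N =
    \sum_(t : d.-tuple 'I_N | (\sum_(k < d) (tnth t k).+1 == N)%N)
        \prod_(k < d) 'X_(tnth t k).
Proof.
rewrite -[d in LHS]card_ord -prodr_const bigA_distr_bigA coef_sum.
rewrite (reindex (fun t : d.-tuple 'I_N => [ffun k => tnth t k])) /=; last first.
  exists (fun f : {ffun 'I_d -> 'I_N} => [tuple f k | k < d]) => [t|f] _.
    by apply: eq_from_tnth => k; rewrite tnth_mktuple ffunE.
  by apply/ffunP => k; rewrite ffunE tnth_mktuple.
rewrite [RHS]big_mkcond; apply: eq_bigr => t _.
under eq_bigr => k _ do rewrite ffunE.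
rewrite scaler_prod prodrXr coefZ coefXn eq_sym.
by case: ifP => _; rewrite ?mulr1 ?mulr0.
Qed.

Lemma Phi_coef :
  Phi R N = \sum_(1 <= d < N.+1) ((-1) ^+ d * d%:R^-1) *: (genpoly ^+ d)`_N.
Proof. by apply: eq_bigr => d _; rewrite coef_genpolyXn. Qed.

Lemma coef_genpoly j :
  genpoly`_j = \sum_(i < N) (if i.+1 == j then 'X_i else 0).
Proof.
rewrite coef_sum; apply: eq_bigr => i _.
by rewrite coefZ coefXn eq_sym; case: eqP; rewrite ?mulr1 ?mulr0.
Qed.

(** U has no constant term, so U^N is divisible by z^N; this disposes of the remainder of the
    geometric sum. *)
Lemma genpoly_divX : exists V, genpoly = V * 'X.
Proof.
exists (\sum_(i < N) 'X_i *: 'X^i); rewrite mulr_suml.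
by apply: eq_bigr => i _; rewrite -scalerAl -exprSr.
Qed.

(** With q = p + 1, the field sends x_j to 1 if j = q, to x_(j-q) if j > q, and to 0 otherwise. The
    bound on j matters: the right side has terms up to degree N + q, the left side none beyond N. *)
Lemma X_field_genpoly (p : 'I_N) j : (j <= N)%N ->
  (map_poly (@X_field R N p) genpoly)`_j = ('X^(p.+1) * (1 + genpoly))`_j.
Proof.
move=> le_jN; rewrite coef_map coefXnM coefD coef1 !coef_genpoly /= raddf_sum.
case: j le_jN => [|j] lt_jN /=.
  by rewrite big1 // => i _; rewrite /= raddf0.
rewrite (bigD1 (Ordinal lt_jN)) //= eqxx big1 => [|i ne_ij]; last first.
  by rewrite eqSS [(i : nat) == j](negbTE ne_ij) raddf0.
rewrite addr0 X_fieldX -[_ == p]/(j == p) !ltnS subSS /=.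
case: (ltngtP j p) => [lt_jp|lt_pj|->]; first by rewrite addr0.
  rewrite subn_eq0 leqNgt lt_pj; congr (_ + _).
  (* Only the variable with zero-based index j - (p+1) sits at z^(j-p). *)
  rewrite (bigD1 (ord_diff (Ordinal lt_jN) p)) //= -subSn // subSS eqxx.
  rewrite big1 ?addr0 // => i; rewrite -val_eqE /= => ne_i.
  by rewrite -[(j - p)%N]prednK ?subn_gt0 // eqSS -subnS (negbTE ne_i).
by rewrite subnn eqxx addr0 big1 ?addr0.
Qed.

End GeneratingPolynomial.

Theorem proposition1 (R : realFieldType) (N : nat) (hN : (2 <= N)%N)
    (p : 'I_N) (hp : (p.+1 < N)%N) :
  X_field p (Phi R N) = 0.
Proof.
rewrite Phi_coef raddf_sum /=; set U := genpoly R N.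
(* The power rule yields a factor d cancelling 1/d, and the sign (-1)^d splits into one global minus
   and the sign of (-U)^(d-1). *)
have XU d : (0 < d)%N ->
    X_field p (((-1) ^+ d * d%:R^-1) *: (U ^+ d)`_N) =
    (- ('X^(p.+1) * ((1 + U) * (- U) ^+ d.-1)))`_N.
  case: d => // d _; rewrite linearZ /= -(coef_map (@X_field R N p)).
  rewrite (map_poly_derivationXn (@X_fieldM R N p)) /= coefMn.
  rewrite -scaler_nat scalerA divfK ?Num.Theory.pnatr_eq0 //.
  (* The z^N-coefficient of a product involves only coefficients of index at most N, where the
     formula for the field on U is valid. *)
  have -> : (U ^+ d * map_poly (X_field p) U)`_N
          = (U ^+ d * ('X^(p.+1) * (1 + U)))`_N.
    rewrite !coefM; apply: eq_bigr => j _.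
    by rewrite X_field_genpoly // leq_subr.
  rewrite mulrC -mulrA [(- U) ^+ d]exprNn exprS mulN1r -2!(signr_odd _ d).
  case: (odd d); rewrite ?expr1 ?expr0 ?mul1r ?mulN1r ?mulrN.
    by rewrite !opprK scale1r.
  by rewrite scaleN1r coefN.
rewrite big_add1 /=; under eq_bigr => d _ do rewrite XU //=.
rewrite big_mkord -coef_sum sumrN -mulr_sumr -mulr_sumr.
(* Geometric sum with ratio -U. *)
have -> : (1 + U) * (\sum_(i < N) (- U) ^+ i) = 1 - (- U) ^+ N.
  by rewrite -[RHS]opprB subrX1 -mulNr opprB opprK.
rewrite /U; have [V ->] := genpoly_divX R N.
(* The term z^(p+1) misses degree N by [hp]; the other one is divisible by z^(p+1+N). *)
rewrite mulrBr mulr1 opprB coefB coefXn gtn_eqF // subr0.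
by rewrite -mulNr exprMn mulrCA -exprD coefMXn addSn ltnS leq_addl.
Qed.
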